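(* Let $S$ be a set with $2 \leq |S|$, let $(X_s)_{s \in S}$ be a family of nonempty racks, and let $X = \ast_{s \in S} X_s$ be their free product. Let $\lambda = (\lambda_s)_{s \in S}$ be a uniformly bounded family of odd bounded functions $\lambda_s \colon \mathrm{Ad}(X_s) \to \mathbb{R}$, and let $\phi_\lambda \colon \ast_{s \in S} \mathrm{Ad}(X_s) \to \mathbb{R}$ be given by $\phi_\lambda(g) = \sum_{i=1}^n \lambda_{s_i}(g_i)$, where $g = g_1 \cdots g_n$ is the factorization of $g$ with $g_i \in \mathrm{Ad}(X_{s_i})$. Then the map $\hat{\phi}_\lambda \colon X \to \mathbb{R}$ defined by $$\hat{\phi}_\lambda(x, g) = \phi_\lambda(g), \quad \text{where } (x, g) \text{ is reduced},$$ is a rack quasimorphism. Moreover, if $\lambda \neq 0$, then $\hat{\phi}_\lambda$ is unbounded.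
   Context: A rack is a set $X$ with a binary operation $\triangleleft \colon X \times X \to X$ such that $(x \triangleleft y) \triangleleft z = (x \triangleleft z) \triangleleft (y \triangleleft z)$ for all $x,y,z \in X$, and for every $y \in X$ the map $x \mapsto x \triangleleft y$ is bijective. The adjoint group of a rack $X$ is $\mathrm{Ad}(X) = \langle e_x \ (x \in X) \mid e_x e_y = e_y e_{x \triangleleft y} \ (x, y \in X) \rangle$. It acts on $X$ from the right by $x \cdot e_y = x \triangleleft y$. Free product of racks: given racks $X_s$ ($s \in S$), the free product $\ast_{s \in S} X_s$ is the set of pairs $(x, g)$ with $x \in X_t$ for some $t \in S$ and $g \in \ast_{s \in S} \mathrm{Ad}(X_s)$ (free product of groups), modulo the equivalence relation generated by $(x, g w) \sim (x \cdot g, w)$ for $t \in S$, $x \in X_t$, $g \in \mathrm{Ad}(X_t)$, $w \in \ast_{s \in S} \mathrm{Ad}(X_s)$. The operation is $(x, g) \triangleleft (y, h) = (x, g h^{-1} e_y h)$, which is well defined. Factorization: every $g \neq 1$ in a free product of groups $\ast_{s \in S} \Gamma_s$ is uniquely a product $g = g_1 \cdots g_n$ with $1 \neq g_i \in \Gamma_{s_i}$ and $s_i \neq s_{i+1}$; this is the factorization of $g$ (for $g = 1$ it is empty, $n = 0$). Reduced: a pair $(x, g)$ with $x \in X_t$ and $g$ with factorization $g_1 \cdots g_n$, $g_1 \in \mathrm{Ad}(X_{s_1})$, is reduced if $s_1 \neq t$ (or $g = 1$). Every element of $\ast_{s \in S} X_s$ is represented by a reduced pair. A family $\lambda = (\lambda_s)_{s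 \in S}$ of functions $\lambda_s \colon \Gamma_s \to \mathbb{R}$ is a uniformly bounded family of odd bounded functions if each $\lambda_s$ is bounded, $\lambda_s(g^{-1}) = -\lambda_s(g)$ for all $g \in \Gamma_s$, and $\sup_{s \in S} \|\lambda_s\|_\infty < \infty$. Here $\lambda \ne 0$ means that some $\lambda_s$ is not identically zero. A rack quasimorphism on a rack $X$ is a function $\phi \colon X \to \mathbb{R}$ with $\sup_{x, y \in X} |\phi(x) - \phi(x \triangleleft y)| < \infty$. *)

(* Defs.v *)
From HB Require Import structures.
From Stdlib Require Import Relation_Operators.
From mathcomp Require Import all_boot all_order all_algebra.
From mathcomp Require Import generic_quotient monoid.
From mathcomp Require Import boolp classical_sets reals topology normedtype.

Set Implicit Arguments.
Unset Strict Implicit.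
Unset Printing Implicit Defensive.

Import Order.TTheory GRing.Theory Num.Theory.
Import numFieldNormedType.Exports.

Section Quotient.
Local Open Scope quotient_scope.
Variables (T : Type) (r : T -> T -> Prop).

Definition generated_rel : rel {classic T} :=
  fun u v => `[< clos_refl_sym_trans T r u v >].

Lemma generated_rel_refl : reflexive generated_rel.
Proof. by move=> u; apply/asboolP; apply: rst_refl. Qed.

Lemma generated_rel_sym : symmetric generated_rel.
Proof. by move=> u v; apply/asboolP/asboolP; apply: rst_sym. Qed.

Lemma generated_rel_trans : transitive generated_rel.
Proof.
move=> v u w /asboolP uv /asboolP vw; apply/asboolP.
exact: rst_trans uv vw.
Qed.

Canonical generated_equiv :=
  EquivRel generated_rel generated_rel_refl generated_rel_sym
    generated_rel_trans.

(* The quotient of [T] by the equivalence relation generated by [r]. *)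
Definition quot := {eq_quot generated_equiv}.
HB.instance Definition _ := Choice.copy quot {eq_quot generated_equiv}.

Definition qpi (u : T) : quot := \pi_quot (u : {classic T}).
Definition qrepr (q : quot) : T := repr q.

Lemma qreprK q : qpi (qrepr q) = q.
Proof. exact: reprK. Qed.

Lemma qpiP u v : qpi u = qpi v <-> clos_refl_sym_trans T r u v.
Proof.
by split=> [/eqmodP/asboolP //|uv]; apply/eqmodP/asboolP.
Qed.

Lemma qpi_ind (P : quot -> Prop) : (forall u, P (qpi u)) -> forall q, P q.
Proof. by move=> Pu q; rewrite -(qreprK q). Qed.

Lemma quot_lift (U : Type) (f : T -> U) :
  (forall u v, r u v -> f u = f v) ->
  forall u, f (qrepr (qpi u)) = f u.
Proof.
move=> fr u.
suff f_rst a b : clos_refl_sym_trans T r a b -> f a = f b.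
  by apply/f_rst/qpiP; rewrite qreprK.
by elim=> // x y z _ -> _ ->.
Qed.
End Quotient.

(* Words in the generators [A] and their formal inverses; the letter
   [(a, false)] stands for [a] and [(a, true)] for its inverse. *)
Definition word (A : Type) : Type := seq (A * bool).

Definition word_inv (A : Type) (w : word A) : word A :=
  rev [seq (a.1, ~~ a.2) | a <- w].

Inductive presentation_step (A : Type) (rels : word A -> word A -> Prop) :
    word A -> word A -> Prop :=
| step_relation u v l r :
    rels l r -> presentation_step rels (u ++ l ++ v) (u ++ r ++ v)
| step_cancel u v a b :
    presentation_step rels (u ++ [:: (a, b); (a, ~~ b)] ++ v) (u ++ v).

(* The group presented by the generators [A] and the relations [l = r]
   for [rels l r]. *)
Definition presented_group (A : Type) (rels : word A -> word A -> Prop) :=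
  quot (presentation_step rels).

Section PresentedGroup.
Variables (A : Type) (rels : word A -> word A -> Prop).
Local Notation G := (presented_group rels).
Local Notation step := (presentation_step rels).
Local Notation pi := (qpi step).

HB.instance Definition _ := Choice.on G.

Definition pg_one : G := pi [::].
Definition pg_mul (g h : G) : G := pi (qrepr g ++ qrepr h).
Definition pg_inv (g : G) : G := pi (word_inv (qrepr g)).

Lemma step_ctx p q u v : step u v -> step (p ++ u ++ q) (p ++ v ++ q).
Proof.
case=> [u' v' l r lr|u' v' a b].
  rewrite -!catA ![p ++ u' ++ _]catA; exact: step_relation.
rewrite -!catA ![p ++ u' ++ _]catA; exact: step_cancel.
Qed.

Lemma pi_ctx p q u v : step u v -> pi (p ++ u ++ q) = pi (p ++ v ++ q).
Proof. by move=> uv; apply/qpiP/rst_step/step_ctx. Qed.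

Lemma pg_mulE u v : pg_mul (pi u) (pi v) = pi (u ++ v).
Proof.
rewrite /pg_mul.
have -> : pi (qrepr (pi u) ++ qrepr (pi v)) = pi (u ++ qrepr (pi v)).
  apply: (quot_lift (f := fun w => pi (w ++ qrepr (pi v)))) => w w' ww'.
  exact: (pi_ctx [::] _ ww').
apply: (quot_lift (f := fun w => pi (u ++ w))) => w w' ww'.
by have := pi_ctx u [::] ww'; rewrite !cats0.
Qed.

Lemma word_inv_cat (u v : word A) :
  word_inv (u ++ v) = word_inv v ++ word_inv u.
Proof. by rewrite /word_inv map_cat rev_cat. Qed.

Lemma word_invK : involutive (@word_inv A).
Proof.
move=> w; rewrite /word_inv map_rev revK -map_comp -[RHS]map_id.
by apply: eq_map => -[a b] /=; rewrite negbK.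
Qed.

Lemma pi_cancel w : pi (w ++ word_inv w) = pg_one.
Proof.
elim: w => [//|[a b] w IH]; rewrite -cat1s word_inv_cat.
have -> : ([:: (a, b)] ++ w) ++ word_inv w ++ word_inv [:: (a, b)] =
  [:: (a, b)] ++ (w ++ word_inv w) ++ word_inv [:: (a, b)] by rewrite !catA.
rewrite -pg_mulE -[pi ((w ++ _) ++ _)]pg_mulE IH.
rewrite [pg_mul pg_one _]pg_mulE pg_mulE; apply/qpiP/rst_step.
exact: (step_cancel rels [::] [::] a b).
Qed.

Lemma pg_mulA : associative pg_mul.
Proof.
by elim/qpi_ind=> u; elim/qpi_ind=> v; elim/qpi_ind=> w; rewrite !pg_mulE catA.
Qed.

Lemma pg_mul1 : left_id pg_one pg_mul.
Proof. by elim/qpi_ind=> u; rewrite pg_mulE. Qed.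

Lemma pg_mulr1 : right_id pg_one pg_mul.
Proof. by elim/qpi_ind=> u; rewrite pg_mulE cats0. Qed.

Lemma pg_mulrV : right_inverse pg_one pg_inv pg_mul.
Proof.
by move=> g; rewrite -{1}[g]qreprK pg_mulE pi_cancel.
Qed.

Lemma pg_mulV : left_inverse pg_one pg_inv pg_mul.
Proof.
move=> g; rewrite -{2}[g]qreprK pg_mulE -{2}[qrepr g]word_invK.
exact: pi_cancel.
Qed.

HB.instance Definition _ :=
  isGroup.Build G pg_mulA pg_mul1 pg_mulr1 pg_mulV pg_mulrV.

Definition generator (a : A) : G := pi [:: (a, false)].

Lemma generator_inv (a : A) : (generator a)^-1%g = pi [:: (a, true)].
Proof.
apply: (@mulgI _ (generator a)); rewrite mulgV; apply/esym.
rewrite [LHS]pg_mulE; exact: (pi_cancel [:: (a, false)]).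
Qed.

Lemma pg_relation l r : rels l r -> pi l = pi r.
Proof. by move=> /step_relation-/(_ [::] [::])/(pi_ctx [::] [::]); rewrite /= !cats0. Qed.

End PresentedGroup.
Arguments generator {A} rels a.

HB.mixin Record isRack (X : Type) := {
  rack_op : X -> X -> X;
  rack_distr : forall x y z,
    rack_op (rack_op x y) z = rack_op (rack_op x z) (rack_op y z);
  rack_bij : forall y, bijective (fun x => rack_op x y)
}.

#[short(type="rackType")]
HB.structure Definition Rack := {X of isRack X}.

Declare Scope rack_scope.
Delimit Scope rack_scope with rack.
Notation "x ◁ y" := (rack_op x y)
  (at level 40, left associativity) : rack_scope.
Local Open Scope rack_scope.

Section Adjoint.
Variable X : rackType.
Implicit Types (x y z : X).

Inductive Ad_relation : word X -> word X -> Prop :=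
| Ad_relation_intro x y :
    Ad_relation [:: (x, false); (y, false)]
                [:: (y, false); (x ◁ y, false)].

Definition Ad := presented_group Ad_relation.
HB.instance Definition _ := Group.on Ad.

Definition ad x : Ad := generator Ad_relation x.

Lemma rack_op_surj x y : exists z, z ◁ y = x.
Proof. by have [f _ fK] := rack_bij y; exists (f x). Qed.

Definition rack_opV x y : X := projT1 (cid (rack_op_surj x y)).

Lemma rack_opVK x y : rack_opV x y ◁ y = x.
Proof. by rewrite /rack_opV; case: cid. Qed.

Lemma rack_opK x y : rack_opV (x ◁ y) y = x.
Proof. by apply: (bij_inj (rack_bij y)); rewrite rack_opVK. Qed.

Definition act_letter x (a : X * bool) : X :=
  if a.2 then rack_opV x a.1 else x ◁ a.1.

(* The right action of [Ad] on [X] with [x . e_y = x ◁ y]. *)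
Definition act x (g : Ad) : X := foldl act_letter x (qrepr g).

Lemma actE x w : act x (qpi _ w) = foldl act_letter x w.
Proof.
apply: (quot_lift (f := fun w => foldl act_letter x w)) => {}w w'.
case=> [u v l r [y z]|u v a b]; rewrite !foldl_cat /=.
  by rewrite /act_letter /= -rack_distr.
by case: b; rewrite /act_letter /= ?rack_opVK ?rack_opK.
Qed.

Lemma act_ad x y : act x (ad y) = x ◁ y.
Proof. exact: actE. Qed.

Lemma act1 x : act x 1%g = x.
Proof. exact: actE. Qed.

Lemma actM x (g h : Ad) : act x (g * h)%g = act (act x g) h.
Proof.
elim/qpi_ind: g => u; elim/qpi_ind: h => v.
by rewrite [(_ * _)%g]pg_mulE !actE foldl_cat.
Qed.

Lemma ad_op x y : ad (x ◁ y) = ((ad y)^-1 * ad x * ad y)%g.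
Proof.
rewrite -mulgA; apply: (mulgI (ad y)); rewrite mulVKg.
apply/esym; rewrite [LHS]pg_mulE [RHS]pg_mulE.
exact: pg_relation (Ad_relation_intro x y).
Qed.

Lemma ad_act x (g : Ad) : ad (act x g) = (g^-1 * ad x * g)%g.
Proof.
elim/qpi_ind: g => w; rewrite actE; elim: w x => [|[y b] w IH] x.
  by rewrite -[qpi _ [::]]/(1%g : Ad) invg1 mul1g mulg1.
rewrite /= IH.
have -> : qpi _ ((y, b) :: w) =
    ((if b then (ad y)^-1 else ad y) * (qpi _ w : Ad))%g :> Ad.
  by case: b; rewrite /ad ?generator_inv [RHS]pg_mulE.
rewrite invgM /act_letter; case: b => /=.
  rewrite invgK; have {2}-> : x = rack_opV x y ◁ y by rewrite rack_opVK.
  by rewrite ad_op !mulgA !mulgK.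
by rewrite ad_op !mulgA.
Qed.
End Adjoint.

Section FreeProduct.
Variables (S : Type) (Gamma : S -> groupType).

Inductive free_product_relation :
    word {s : S & Gamma s} -> word {s : S & Gamma s} -> Prop :=
| free_product_relation_intro s (g h : Gamma s) :
    free_product_relation
      [:: (existT Gamma s g, false); (existT Gamma s h, false)]
      [:: (existT Gamma s (g * h)%g, false)].

(* Generators: the disjoint union of the groups; relations: the
   multiplication table of each of them. *)
Definition free_product := presented_group free_product_relation.
HB.instance Definition _ := Group.on free_product.

Definition free_product_in (s : S) (g : Gamma s) : free_product :=
  generator free_product_relation (existT Gamma s g).

Lemma free_product_inM s (g h : Gamma s) :
  free_product_in (g * h)%g = (free_product_in g * free_product_in h)%g.
Proof.
rewrite [RHS]pg_mulE; apply/esym.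
exact: pg_relation (free_product_relation_intro g h).
Qed.

Lemma free_product_in1 s : free_product_in (1%g : Gamma s) = 1%g.
Proof.
by apply: (mulgI (free_product_in (1%g : Gamma s))); rewrite -free_product_inM !mulg1.
Qed.

Lemma free_product_inV s (g : Gamma s) :
  free_product_in (g^-1)%g = (free_product_in g)^-1%g.
Proof.
apply: (mulgI (free_product_in g)).
by rewrite -free_product_inM !mulgV free_product_in1.
Qed.

Definition is_factorization (g : free_product) (w : seq {s : S & Gamma s}) :=
  [/\ all (fun a : {s : S & Gamma s} => tagged a != 1%g) w,
      sorted (fun a b : {s : S & Gamma s} => `[< tag a <> tag b >]) w
    & (\prod_(a <- w) free_product_in (tagged a))%g = g].

(* The default value is never used: every element of a free product has
   a unique factorization. *)
Definition factorization (g : free_product) : seq {s : S & Gamma s} :=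
  xget ([::] : {classic seq {s : S & Gamma s}})
    [set w | is_factorization g w]%classic.

End FreeProduct.
Arguments free_product_in {S} Gamma s g.

Section FreeProductRack.
Variables (S : Type) (X : S -> rackType).
Local Notation AdX := (fun s => Ad (X s) : groupType).
Local Notation F := (free_product AdX).

Definition rack_pair : Type := ({s : S & X s} * F)%type.

Inductive rack_pair_step : rack_pair -> rack_pair -> Prop :=
| rack_pair_step_intro t (x : X t) (g : Ad (X t)) (w : F) :
    rack_pair_step (existT X t x, (free_product_in AdX t g * w)%g)
                   (existT X t (act x g), w).

Definition free_product_rack := quot rack_pair_step.

Definition fpr_class (p : rack_pair) : free_product_rack :=
  qpi rack_pair_step p.

Definition fpr_ad (a : {s : S & X s}) : F :=
  free_product_in AdX (tag a) (ad (tagged a)).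

Definition pair_op (p q : rack_pair) : rack_pair :=
  (p.1, (p.2 * q.2^-1 * fpr_ad q.1 * q.2)%g).

Definition fpr_op (u v : free_product_rack) : free_product_rack :=
  fpr_class (pair_op (qrepr u) (qrepr v)).

Lemma fpr_classM p q (k : F) : rack_pair_step p q ->
  fpr_class (p.1, (p.2 * k)%g) = fpr_class (q.1, (q.2 * k)%g).
Proof.
by case=> t x g w /=; apply/qpiP/rst_step; rewrite -mulgA.
Qed.

Lemma fpr_opE p q : fpr_op (fpr_class p) (fpr_class q) = fpr_class (pair_op p q).
Proof.
rewrite /fpr_op; set q' := qrepr (fpr_class q).
transitivity (fpr_class (pair_op p q')).
  apply: (quot_lift (f := fun p => fpr_class (pair_op p q'))) => {}p p'.
  by rewrite /pair_op -!mulgA; apply: fpr_classM.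
apply: (quot_lift (f := fun q => fpr_class (pair_op p q))) => {q'} {}q q'.
case=> t y g h; rewrite /pair_op /fpr_ad /=; congr (fpr_class (_, _)).
by rewrite ad_act !free_product_inM free_product_inV invgM !mulgA.
Qed.

Lemma fpr_distr u v w :
  fpr_op (fpr_op u v) w = fpr_op (fpr_op u w) (fpr_op v w).
Proof.
elim/qpi_ind: u => -[x g]; elim/qpi_ind: v => -[y h]; elim/qpi_ind: w => -[z k].
rewrite -![qpi _ _]/(fpr_class _) !fpr_opE /pair_op /=.
congr (fpr_class (_, _)).
by rewrite !invgM !invgK !mulgA !mulgK !mulgVK.
Qed.

Lemma fpr_bij v : bijective (fun u => fpr_op u v).
Proof.
elim/qpi_ind: v => -[y h]; pose k := (h^-1 * fpr_ad y * h)%g.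
have opE p : fpr_op (fpr_class p) (fpr_class (y, h)) = fpr_class (p.1, (p.2 * k)%g).
  by rewrite fpr_opE /pair_op /= /k !mulgA.
pose f (u : free_product_rack) : free_product_rack :=
    fpr_class ((qrepr u).1, ((qrepr u).2 * k^-1)%g).
have fE p : f (fpr_class p) = fpr_class (p.1, (p.2 * k^-1)%g).
  apply: (quot_lift (f := fun p => fpr_class (p.1, (p.2 * k^-1)%g))) => {}p p'.
  exact: fpr_classM.
exists f; elim/qpi_ind => -[x g].
  by rewrite -![qpi _ _]/(fpr_class _) opE fE /= mulgK.
by rewrite -![qpi _ _]/(fpr_class _) fE opE /= mulgVK.
Qed.

HB.instance Definition _ := isRack.Build free_product_rack fpr_distr fpr_bij.

Definition reduced (p : rack_pair) : Prop :=
  if factorization p.2 is a :: _ then tag a <> tag p.1 else True.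

End FreeProductRack.

Section Quasimorphism.
Local Open Scope ring_scope.
Local Open Scope classical_set_scope.
Variable R : realType.

Definition rack_quasimorphism (X : rackType) (phi : X -> R) : Prop :=
  has_ubound [set `|phi x - phi (x ◁ y)| | x in [set: X] & y in [set: X]].

Definition uniformly_bounded_odd_family (S : Type) (Gamma : S -> groupType)
    (lambda : forall s, Gamma s -> R) : Prop :=
  [/\ forall s, bounded_fun (lambda s),
      forall s g, lambda s (g^-1)%g = - lambda s g
    & exists M : R, forall s g, `|lambda s g| <= M].

Definition phi_of (S : Type) (Gamma : S -> groupType)
    (lambda : forall s, Gamma s -> R) (g : free_product Gamma) : R :=
  \sum_(a <- factorization g) lambda (tag a) (tagged a).

(* [phihat] takes the value [phi_of lambda g] on the class of every reduced
   pair [(x, g)]. *)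
Definition is_phi_hat (S : Type) (X : S -> rackType)
    (lambda : forall s, Ad (X s) -> R) (phihat : free_product_rack X -> R) :=
  forall p : rack_pair X, reduced p ->
    phihat (fpr_class p) = phi_of lambda p.2.

End Quasimorphism.

(* Main.v *)
(** Letting each factor [Gamma s] act on normal words by left multiplication
    (van der Waerden's trick) gives the free product an action on normal words;
    applied to the empty word it computes the factorization. Writing
    [g = h w] with [h] in [Gamma t] and [w] not starting in [Gamma t], the word
    [w] does not change when [g] is multiplied on the left by [Gamma t], so
    [phi w] is an invariant of the class of [(x, g)] for [x] in [X t]: it is
    the value of the lift at this class, and it is within [M = sup |lambda|] of
    [phi g].  In a product of two normal words the letters that cancel
    contribute opposite terms by oddness, and at most one pair of letters
    merges, so [phi] has defect at most [3 M], and
    [phi (g h^-1 e_y h)] stays within [13 M] of [phi g].  For unboundedness,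
    if [lambda s g <> 0] and [e] is a generator of [Ad (X t)] with [t <> s], then
    [lambda s g + lambda t e] or [lambda s g - lambda t e] is a nonzero [c], and
    the class of [(y, (g e)^n)] or [(y, (g e^-1)^n)] has value [n c]. *)

From Stdlib Require Import Relation_Operators.
Require Import Defs.
From mathcomp Require Import all_boot all_order all_algebra monoid lra.
From mathcomp Require Import boolp classical_sets reals topology normedtype.
Import Order.TTheory GRing.Theory Num.Theory.
Import numFieldNormedType.Exports.
Local Open Scope ring_scope.
Local Open Scope classical_set_scope.

Set Implicit Arguments.
Unset Strict Implicit.
Unset Printing Implicit Defensive.

(** * Normal words and the action of the free product on them *)

Section NormalForm.
Variables (S : Type) (Gamma : S -> groupType).
Local Notation F := (free_product Gamma).
Local Notation letter := {s : S & Gamma s}.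
Local Notation "s ## g" := (existT (fun i => Gamma i) s g) (at level 20).
Implicit Types (s t : S) (a b : letter) (u v w : seq letter).

Definition normal w :=
  all (fun a : letter => tagged a != 1%g) w /\
  sorted (fun a b : letter => `[< tag a <> tag b >]) w.

Definition avoids t w := if w is a :: _ then tag a <> t else True.

(** The leading letter is transported to [Gamma t] along the equality of tags. When [w] does not
    start in [Gamma t] the first component is 1, so every normal word is [push g w'] with [w']
    avoiding [t]. *)
Definition peel t w : Gamma t * seq letter :=
  if w is a :: w' then
    if pselect (tag a = t) is left e
    then (eq_rect (tag a) Gamma (tagged a) t e, w') else (1%g, w)
  else (1%g, w).

Definition push t (g : Gamma t) w := if g == 1%g then w else t ## g :: w.

Definition nf_mul a w :=
  push (tagged a * (peel (tag a) w).1)%g (peel (tag a) w).2.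

Lemma normal_cons a w :
  normal (a :: w) <-> [/\ tagged a != 1%g, avoids (tag a) w & normal w].
Proof.
rewrite /normal; case: w => [|b w] /=; first by split=> [[/andP[]]|[-> _ []]].
split=> [[/andP[-> ->] /andP[/asboolP ab ->]]|[-> ba [-> ->]]].
  by split=> //; apply: not_eq_sym.
by split=> //; rewrite andbT; apply/asboolP/not_eq_sym.
Qed.

Lemma normal_cat_cons u a v :
  normal (u ++ a :: v) <-> normal (rcons u a) /\ normal (a :: v).
Proof.
elim: u => [|b u IH]; first split=> [nav|[]//]; first split=> //.
  by apply/normal_cons; case/normal_cons: nav.
have av : avoids (tag b) (u ++ a :: v) = avoids (tag b) (rcons u a).
  by case: (u).
split=> [/normal_cons[b1 bu /IH[nu nv]]|[/normal_cons[b1 bu nu] nv]].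
  by split=> //; apply/normal_cons; rewrite -av.
by apply/normal_cons; rewrite av; split=> //; apply/IH.
Qed.

Lemma peel_same t (g : Gamma t) w : peel t (t ## g :: w) = (g, w).
Proof.
by rewrite /peel /=; case: pselect => // e; rewrite (Prop_irrelevance e erefl).
Qed.

Lemma peel_avoids t w : avoids t w -> peel t w = (1%g, w).
Proof. by case: w => //= a w; case: pselect. Qed.

Lemma peel_push t (g : Gamma t) w : avoids t w -> peel t (push g w) = (g, w).
Proof.
by rewrite /push; case: eqP => [->|_] aw; [rewrite peel_avoids|rewrite peel_same].
Qed.

Variant peel_spec t w : Gamma t * seq letter -> Prop :=
  PeelSpec g w' of w = push g w' & avoids t w' & normal w' : peel_spec w (g, w').

Lemma peelP t w : normal w -> peel_spec w (peel t w).
Proof.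
case: w => [|a w]; first by split=> //; rewrite /push eqxx.
case: (pselect (tag a = t)) => [at_|nat] naw; last first.
  by rewrite peel_avoids //; split=> //; rewrite /push eqxx.
case: a at_ naw => s g st naw; rewrite -{}st peel_same.
have [/= g1 aw nw] := (normal_cons _ _).1 naw.
by split=> //; rewrite /push (negPf g1).
Qed.

Lemma push_normal t (g : Gamma t) w : avoids t w -> normal w -> normal (push g w).
Proof. by rewrite /push; case: eqP => // /eqP g1 aw nw; apply/normal_cons. Qed.

Lemma nf_mul_normal a w : normal w -> normal (nf_mul a w).
Proof.
by move=> nw; rewrite /nf_mul; case: peelP => //= *; apply: push_normal.
Qed.

Lemma nf_mul1 s w : normal w -> nf_mul (s ## 1%g) w = w.
Proof.
move=> nw; rewrite /nf_mul /=; case: peelP => //= g w' ->.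
by rewrite mul1g.
Qed.

Lemma peel_nf_mul s (g : Gamma s) w : normal w ->
  peel s (nf_mul (s ## g) w) = ((g * (peel s w).1)%g, (peel s w).2).
Proof.
by move=> nw; rewrite /nf_mul /=; case: (peelP s nw) => *; rewrite peel_push.
Qed.

(** In the coordinates given by [peel s], the group [Gamma s] acts by left multiplication on the
    first component and fixes the second. *)
Lemma nf_mulM s (g h : Gamma s) w : normal w ->
  nf_mul (s ## g) (nf_mul (s ## h) w) = nf_mul (s ## (g * h)%g) w.
Proof. by move=> nw; rewrite {1}/nf_mul /= peel_nf_mul //= mulgA. Qed.

Lemma nf_mul_cons a w : normal (a :: w) -> nf_mul a w = a :: w.
Proof.
case: a => s g /normal_cons[/= g1 aw nw].
by rewrite /nf_mul peel_avoids //= mulg1 /push (negPf g1).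
Qed.

Definition nf_letter (c : letter * bool) : letter :=
  if c.2 then tag c.1 ## (tagged c.1)^-1%g else c.1.

Definition nf_word (l : word letter) :=
  foldr (fun c w => nf_mul (nf_letter c) w) [::] l.

Definition nf (g : F) := nf_word (qrepr g).

Lemma foldr_normal l w : normal w ->
  normal (foldr (fun c w => nf_mul (nf_letter c) w) w l).
Proof. by move=> nw; elim: l => //= c l IH; apply: nf_mul_normal. Qed.

(** Both kinds of presentation step act trivially on normal words, by [nf_mulM] and [nf_mul1]. *)
Lemma nf_pi l : nf (qpi _ l) = nf_word l.
Proof.
apply: (quot_lift (f := nf_word)) => {}l l' [u v _ _ [s g h]|u v [s g] b];
  rewrite /nf_word !foldr_cat; congr foldr; set w := foldr _ _ v => /=;
  have nw : normal w by apply: foldr_normal.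
  exact: nf_mulM.
by case: b; rewrite /nf_letter /= nf_mulM // ?mulVg ?mulgV nf_mul1.
Qed.

Lemma nf_normal g : normal (nf g).
Proof. exact: foldr_normal. Qed.

Definition word_prod w : F := (\prod_(a <- w) free_product_in Gamma (tag a) (tagged a))%g.

Lemma word_prod_nil : word_prod [::] = 1%g.
Proof. exact: big_nil. Qed.

Lemma word_prod_cons a w :
  word_prod (a :: w) = (free_product_in Gamma (tag a) (tagged a) * word_prod w)%g.
Proof. exact: big_cons. Qed.

Lemma word_prod_cat u v : word_prod (u ++ v) = (word_prod u * word_prod v)%g.
Proof. exact: big_cat. Qed.

Lemma word_prod_push t (g : Gamma t) w :
  word_prod (push g w) = (free_product_in Gamma t g * word_prod w)%g.
Proof.
rewrite /push; case: eqP => [->|_]; first by rewrite free_product_in1 mul1g.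
exact: word_prod_cons.
Qed.

Lemma word_prod_nf_mul a w : normal w ->
  word_prod (nf_mul a w) = (free_product_in Gamma (tag a) (tagged a) * word_prod w)%g.
Proof.
move=> nw; rewrite /nf_mul; case: peelP => //= g w' -> _ _.
by rewrite !word_prod_push free_product_inM mulgA.
Qed.

Lemma nf_in_mul s (g : Gamma s) (h : F) :
  nf (free_product_in Gamma s g * h)%g = nf_mul (s ## g) (nf h).
Proof. by elim/qpi_ind: h => l; rewrite [(_ * _)%g]pg_mulE !nf_pi. Qed.

Lemma nfK g : word_prod (nf g) = g.
Proof.
elim/qpi_ind: g => l; rewrite nf_pi; elim: l => [|c l IH]; first exact: word_prod_nil.
rewrite /= word_prod_nf_mul; last exact: foldr_normal.
rewrite IH -cat1s -[RHS]pg_mulE; congr (_ * _)%g.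
case: c => -[s g] [] //=.
by rewrite /nf_letter /= free_product_inV; apply: generator_inv.
Qed.

Lemma word_prodK w : normal w -> nf (word_prod w) = w.
Proof.
elim: w => [_|a w IH naw]; first by rewrite word_prod_nil [LHS]nf_pi.
have [_ _ nw] := (normal_cons _ _).1 naw.
by rewrite word_prod_cons nf_in_mul IH //; case: a naw => s g; apply: nf_mul_cons.
Qed.

(** [nfK] gives existence and [word_prodK] uniqueness, so the default value of [xget] is never
    reached. *)
Lemma factorizationE g : factorization g = nf g.
Proof.
rewrite /factorization; case: xgetP => [w _ [nt srt <-]|nofact].
  by rewrite [RHS]word_prodK.
by have [] := nofact (nf g); have [] := nf_normal g; split=> //; apply: nfK.
Qed.

Lemma factorization_word_prod w : normal w -> factorization (word_prod w) = w.
Proof. by move=> nw; rewrite factorizationE word_prodK. Qed.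

(** Normality sees only the tag and the nontriviality of the last letter; this serves for merged
    letters. *)
Lemma normal_rcons_lift u s (g h : Gamma s) :
  normal (rcons u (s ## g)) -> h != 1%g -> normal (rcons u (s ## h)).
Proof.
move=> nu h1; elim: u nu => [|b u IH] nu; first by apply/normal_cons.
have [/= b1 bu {}nu] := (normal_cons _ _).1 nu.
by apply/normal_cons; split=> //; [case: (u) bu | apply: IH].
Qed.

Lemma normal_belast u a : normal (rcons u a) -> normal u.
Proof.
elim: u => [//|b u IH] /normal_cons[b1 bu /IH nu].
by apply/normal_cons; split=> //; case: (u) bu.
Qed.

Definition alternating a b n := flatten (nseq n [:: a; b]).

Lemma alternating_normal a b n : tag a <> tag b ->
  tagged a != 1%g -> tagged b != 1%g -> normal (alternating a b n).
Proof.
move=> ab a1 b1; elim: n => [//|n IH].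
apply/normal_cons; split=> //=; first exact: not_eq_sym.
by apply/normal_cons; split=> //; case: n {IH}.
Qed.

End NormalForm.

(** * Weights of normal words and the defect of [phi] *)

Section Weight.
Variables (R : realType) (S : Type) (Gamma : S -> groupType).
Variables (lambda : forall s, Gamma s -> R) (M : R).
Hypothesis lambdaV : forall s (g : Gamma s), lambda (g^-1)%g = - lambda g.
Hypothesis lambda_le : forall s (g : Gamma s), `|lambda g| <= M.
Hypothesis M_ge0 : 0 <= M.
Local Notation F := (free_product Gamma).
Local Notation letter := {s : S & Gamma s}.
Local Notation phi := (phi_of lambda).

Definition weight (w : seq letter) : R := \sum_(a <- w) lambda (tagged a).

Lemma phi_of_weight g : phi g = weight (nf g).
Proof. by rewrite /phi_of factorizationE. Qed.

Lemma odd_fun1 s : lambda (1%g : Gamma s) = 0.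
Proof. by have := lambdaV (1%g : Gamma s); rewrite invg1; lra. Qed.

Lemma weight_nil : weight [::] = 0. Proof. exact: big_nil. Qed.

Lemma weight_cons a w : weight (a :: w) = lambda (tagged a) + weight w.
Proof. exact: big_cons. Qed.

Lemma weight_cat u v : weight (u ++ v) = weight u + weight v.
Proof. exact: big_cat. Qed.

Lemma weight_push t (g : Gamma t) w : weight (push g w) = lambda g + weight w.
Proof.
rewrite /push; case: eqP => [->|_]; first by rewrite odd_fun1 add0r.
exact: weight_cons.
Qed.

Lemma weight_alternating a b n :
  weight (alternating a b n) = (lambda (tagged a) + lambda (tagged b)) *+ n.
Proof.
elim: n => [|n IH]; first exact: weight_nil.
by rewrite -[alternating a b n.+1]/[:: a, b & alternating a b n] !weight_cons IH
  mulrS addrA.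
Qed.

(** Induction on [u] from its last letter, the one that meets [v]. *)
Lemma weight_defect u v : normal u -> normal v ->
  `|weight (nf (word_prod u * word_prod v)%g) - weight u - weight v| <= 3 * M.
Proof.
elim/last_ind: u v => [|u [s x] IH] v nu nv.
  rewrite word_prod_nil mul1g word_prodK // weight_nil subr0 subrr.
  by rewrite normr0 mulr_ge0.
(* If [v] does not start in [Gamma s], then [y] is 1 and the merged letter [x * y] is just [x], so
   this case needs no separate treatment. *)
have [y v' -> sv nv'] := peelP s nv.
have -> : (word_prod (rcons u (existT _ s x)) * word_prod (push y v') =
    word_prod u * word_prod (push (x * y) v'))%g.
  rewrite -cats1 word_prod_cat word_prod_cons !word_prod_push free_product_inM.
  by rewrite /= word_prod_nil mulg1 !mulgA.
rewrite -cats1 weight_cat weight_cons weight_nil weight_push /= addr0.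
(* If [x] and [y] cancel, their weights are opposite and the defect is that of the shorter words.
   Otherwise it is made of the three values at [x], [y] and [x * y]. *)
have [xy1|xy1] := eqVneq (x * y)%g 1%g.
  rewrite /push xy1 eqxx; have := IH _ (normal_belast nu) nv'.
  have -> : y = (x^-1)%g by apply: (mulgI x); rewrite xy1 mulgV.
  by rewrite lambdaV; congr (`|_| <= _); lra.
have nxy : normal (u ++ existT _ s (x * y)%g :: v').
  apply/normal_cat_cons; split; first exact: normal_rcons_lift nu xy1.
  exact/normal_cons.
rewrite /push (negPf xy1) -word_prod_cat word_prodK // weight_cat weight_cons /=.
have := lambda_le x; have := lambda_le y; have := lambda_le (x * y)%g.
by rewrite !ler_norml; lra.
Qed.

Lemma phi_of_defect (g h : F) : `|phi (g * h)%g - phi g - phi h| <= 3 * M.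
Proof.
rewrite !phi_of_weight -{1}(nfK g) -{1}(nfK h).
by apply: weight_defect; apply: nf_normal.
Qed.

Lemma phi_of1 : phi 1%g = 0.
Proof.
by rewrite phi_of_weight -(word_prod_nil Gamma) word_prodK ?weight_nil.
Qed.

Lemma phi_of_in s (g : Gamma s) : phi (free_product_in Gamma s g) = lambda g.
Proof.
rewrite phi_of_weight -[free_product_in _ _ _]mulg1 nf_in_mul /nf_mul.
by rewrite -(word_prod_nil Gamma) word_prodK //= mulg1 weight_push weight_nil addr0.
Qed.

(** Four defects of [3 * M], one of them to compare [phi h^-1] with [- phi h], and [M] for
    [lambda e]. *)
Lemma phi_of_conj_le (g h : F) s (e : Gamma s) :
  `|phi (g * h^-1 * free_product_in Gamma s e * h)%g - phi g| <= 13 * M.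
Proof.
have := phi_of_defect (g * h^-1 * free_product_in Gamma s e)%g h.
have := phi_of_defect (g * h^-1)%g (free_product_in Gamma s e).
have := phi_of_defect g h^-1%g; have := phi_of_defect h^-1%g h.
have := lambda_le e; rewrite mulVg phi_of1 phi_of_in !ler_norml; lra.
Qed.

Definition tail_weight t (g : F) : R := weight (peel t (nf g)).2.

Lemma tail_weight_in_mul t (g : Gamma t) (h : F) :
  tail_weight t (free_product_in Gamma t g * h)%g = tail_weight t h.
Proof. by rewrite /tail_weight nf_in_mul peel_nf_mul //; apply: nf_normal. Qed.

Lemma tail_weight_avoids t (g : F) :
  avoids t (factorization g) -> tail_weight t g = phi g.
Proof.
by rewrite factorizationE phi_of_weight /tail_weight => av; rewrite peel_avoids.
Qed.

Lemma tail_weight_le t (g : F) : `|tail_weight t g - phi g| <= M.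
Proof.
rewrite phi_of_weight /tail_weight.
have [h w -> _ _] := peelP t (nf_normal g).
by rewrite weight_push distrC addrK.
Qed.

End Weight.

(** * The exponent sum on the adjoint group *)

Section Exponent.
Variable X : rackType.

Definition exponent (w : word X) : int :=
  foldr (fun c n => (if c.2 then -1 else 1) + n) 0 w.

Lemma exponent_cat u v : exponent (u ++ v) = exponent u + exponent v.
Proof. by elim: u => [|c u IH] /=; rewrite ?add0r // IH addrA. Qed.

(** Both sides of each defining relation have exponent sum 2, so the sum descends to [Ad X]; it is 1
    at a generator and 0 at the identity. *)
Lemma ad_neq1 (x : X) : ad x != 1%g.
Proof.
have expE u : exponent (qrepr (qpi (presentation_step (@Ad_relation X)) u)) = exponent u.
  apply: (quot_lift (f := exponent)) => {}u u'.
  case=> [p q l r [y z]|p q y b]; rewrite !exponent_cat //.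
  by case: b; rewrite /= !addr0 ?subrr ?addNr add0r.
apply/eqP => ad1; have := expE [::].
by rewrite -[qpi _ [::]]/(1%g : Ad X) -ad1 expE.
Qed.

End Exponent.

(** * The lift to the free product of racks *)

Section Hat.
Variables (R : realType) (S : Type) (X : S -> rackType).
Local Notation AdX := (fun s => Ad (X s) : groupType).
Variable lambda : forall s, Ad (X s) -> R.

Definition phi_hat (u : free_product_rack X) : R :=
  tail_weight (Gamma := AdX) lambda (tag (qrepr u).1) (qrepr u).2.

Lemma phi_hat_class p :
  phi_hat (fpr_class p) = tail_weight (Gamma := AdX) lambda (tag p.1) p.2.
Proof.
apply: (quot_lift
  (f := fun p : rack_pair X => tail_weight (Gamma := AdX) lambda (tag p.1) p.2)).
by move=> {}p p' [t x g w] /=; apply: tail_weight_in_mul.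
Qed.

Lemma phi_hatP : is_phi_hat lambda phi_hat.
Proof. by move=> p rp; rewrite phi_hat_class; apply: tail_weight_avoids. Qed.

(** The leading letter of [g], if it lies in [Ad (X t)], is absorbed by letting it act on [x]. *)
Lemma reduced_class (u : free_product_rack X) :
  exists2 p, reduced p & fpr_class p = u.
Proof.
elim/qpi_ind: u => -[[t x] g]; have [h w nfg tw nw] := peelP t (nf_normal g).
exists (existT _ t (act x h), word_prod w).
  by rewrite /reduced factorization_word_prod.
apply/esym/qpiP/rst_step; rewrite -{1}(nfK g) nfg word_prod_push.
exact: rack_pair_step_intro.
Qed.

Lemma is_phi_hat_unique f h : is_phi_hat lambda f -> is_phi_hat lambda h -> f = h.
Proof.
move=> fP hP; apply/funext => u; have [p rp <-] := reduced_class u.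
by rewrite fP ?hP.
Qed.

End Hat.

Theorem proposition3p4 (R : realType) (S : Type) (X : S -> rackType)
    (hS : exists s t : S, s <> t)
    (hX : forall s, inhabited (X s))
    (lambda : forall s, Ad (X s) -> R)
    (hlambda : @uniformly_bounded_odd_family R S (fun s => Ad (X s)) lambda) :
  (exists! phihat : free_product_rack X -> R, is_phi_hat lambda phihat) /\
  forall phihat : free_product_rack X -> R, is_phi_hat lambda phihat ->
    rack_quasimorphism phihat /\
    ((exists s g, lambda s g <> 0) -> ~ bounded_fun phihat).
Proof.
have [_ lambdaV [M lambda_le]] := hlambda.
have M_ge0 : 0 <= M.
  by have [s _] := hS; apply: le_trans (lambda_le s 1%g).
split.
  exists (phi_hat lambda); split=> [|f]; first exact: phi_hatP.
  exact/is_phi_hat_unique/phi_hatP.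
move=> f fP; split.
  rewrite (is_phi_hat_unique fP (phi_hatP lambda)).
  (* The operation keeps the first component, so both tail weights are taken at [tag x]. Passing
     from each to [phi] costs [M], on top of [13 * M]. *)
  exists (15 * M) => _ [u _ [v _ <-]].
  elim/qpi_ind: u => -[x g]; elim/qpi_ind: v => -[y h].
  rewrite [rack_op _ _]fpr_opE !phi_hat_class /pair_op /=.
  set k := (_ * h)%g.
  have := tail_weight_le lambdaV lambda_le (tag x) g.
  have := tail_weight_le lambdaV lambda_le (tag x) k.
  have := phi_of_conj_le lambdaV lambda_le M_ge0 g h (ad (tagged y)).
  rewrite -/k !ler_norml; lra.
move=> [s [g lg]] [B [_ fB]].
have [t ts] : exists t, s <> t.
  have [t1 [t2 t12]] := hS; case: (pselect (s = t1)) => [->|]; last by exists t1.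
  by exists t2.
have [y] := hX t.
(* If the sum vanishes for [ad y], oddness makes it twice [lambda s g] for the inverse. *)
have [a a1 lga] : exists2 a : Ad (X t), a != 1%g & lambda s g + lambda t a != 0.
  have [lga|] := eqVneq (lambda s g + lambda t (ad y)) 0; last first.
    by exists (ad y) => //; apply: ad_neq1.
  exists (ad y)^-1%g; first by rewrite invg_eq1 ad_neq1.
  by rewrite lambdaV; apply/eqP; lra.
have g1 : g != 1%g.
  by apply/eqP => g1; apply: lg; rewrite g1 (odd_fun1 lambdaV).
pose w n := alternating (existT (fun s => Ad (X s) : groupType) s g) (existT _ t a) n.
have nw n : normal (w n) by apply: alternating_normal.
have fw n : f (fpr_class (existT _ t y, word_prod (w n))) =
    (lambda s g + lambda t a) *+ n.
  (* The pair is reduced: the word is empty or starts with tag [s], while [y] lies in [X t]. *)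
  rewrite fP; last by rewrite /reduced factorization_word_prod //; case: n.
  by rewrite phi_of_weight word_prodK // weight_alternating.
pose c := `|lambda s g + lambda t a|.
have c_gt0 : 0 < c by rewrite normr_gt0.
(* [bounded_fun] provides every bound strictly above [B]; [B + 1] is one of them. *)
have le n : c *+ n <= B + 1.
  by rewrite -normrMn -fw; apply: fB => //; rewrite ltrDl.
have := le (Num.truncn ((B + 1) / c)).+1.
by rewrite leNgt -mulr_natr mulrC -ltr_pdivrMr // truncnS_gt.
Qed.
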